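(* Let $0<\alpha<1$, $h_1,\dots,h_n>1$ and $\Omega=\prod_{j=1}^n(1,h_j)\subset\mathbb{R}^n$. Let $a_j,b_j,c,F$ ($j=1,\dots,n$) be given real functions on $\overline\Omega$ with $b_j(x)<0$ for every $j$ and $c(x)\le 0$ for all $x\in\overline\Omega$. Let $u\in C^2(\Omega)\cap C^1(\overline\Omega)$ satisfy $$\Delta_x u(x)+\sum_{j=1}^n a_j(x)\frac{\partial u}{\partial x_j}(x)+\sum_{j=1}^n b_j(x)D_{x_j}^{\alpha}u(x)+c(x)u(x)=F(x),\quad x\in\Omega .$$ If $F(x)\ge 0$, then $$\max_{x\in\overline\Omega}u(x)\ \le\ \max_{x\in\partial\Omega}\{u(x),0\},$$ where $\partial\Omega$ is the boundary of $\Omega$.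
   Context: $\Delta_x=\sum_{j=1}^n\partial^2/\partial x_j^2$. $D_{x_j}^{\alpha}$ is the Hadamard fractional derivative of order $\alpha$ in the variable $x_j$ with base point $1$ (other variables fixed): $$D_{x_j}^{\alpha}u(x)=\frac{1}{\Gamma(1-\alpha)}\,x_j\frac{\partial}{\partial x_j}\int_1^{x_j}\left(\log\frac{x_j}{s}\right)^{-\alpha}u(x_1,\dots,x_{j-1},s,x_{j+1},\dots,x_n)\,\frac{ds}{s}.$$ The notation $\max_{x\in\partial\Omega}\{u(x),0\}$ means $\max\{\max_{\partial\Omega}u,\,0\}$. *)

(* Defs.v *)
From HB Require Import structures.
From mathcomp Require Import all_boot all_order all_algebra.
From mathcomp Require Import all_classical all_reals all_analysis.
Set Implicit Arguments.
Unset Strict Implicit.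
Unset Printing Implicit Defensive.
Import Order.TTheory GRing.Theory Num.Theory.
Import numFieldNormedType.Exports.
Local Open Scope classical_set_scope.
Local Open Scope ring_scope.

(* Points of R^n are row vectors. Functions on a subset of R^n are total
   functions of which only the values on the subset matter. *)

Definition partial (R : realType) (n : nat) (j : 'I_n)
    (f : 'rV[R]_n -> R) (x : 'rV[R]_n) : R :=
  derive f x (delta_mx 0 j).

Definition laplacian (R : realType) (n : nat)
    (f : 'rV[R]_n -> R) (x : 'rV[R]_n) : R :=
  \sum_(j < n) partial j (partial j f) x.

(* C^k on an open set A. *)
Fixpoint Ck (R : realType) (n : nat) (k : nat) (A : set 'rV[R]_n)
    (f : 'rV[R]_n -> R) : Prop :=
  {within A, continuous f} /\
  (if k is k'.+1 then
     forall j : 'I_n, (forall x, A x -> derivable f x (delta_mx 0 j)) /\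
                      Ck k' A (partial j f)
   else True).

(* C^1 up to the boundary of an open set A: f is continuous on the closure,
   and its first partial derivatives on A extend continuously to the closure. *)
Definition C1_closure (R : realType) (n : nat) (A : set 'rV[R]_n)
    (f : 'rV[R]_n -> R) : Prop :=
  {within closure A, continuous f} /\
  forall j : 'I_n, (forall x, A x -> derivable f x (delta_mx 0 j)) /\
    exists2 g : 'rV[R]_n -> R, {within closure A, continuous g} &
      forall x, A x -> g x = partial j f x.

Definition boundary (T : topologicalType) (A : set T) : set T :=
  closure A `\` interior A.

Definition is_max (R : realType) (S : set R) (m : R) : Prop :=
  S m /\ ubound S m.

(* Euler's integral: this is the Gamma function only for z > 0. *)
Definition Gamma (R : realType) (z : R) : R :=
  \int[@lebesgue_measure R]_(t in `]0, +oo[) (t `^ (z - 1) * expR (- t)).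

Definition set_coord (R : realType) (n : nat) (x : 'rV[R]_n) (j : 'I_n)
    (s : R) : 'rV[R]_n :=
  \row_k (if k == j then s else x 0 k).

(* The integrand is singular at s = y_j. This endpoint is a null set for the
   Lebesgue integral (powR gives 0 `^ (- alpha) the value 0 there). *)
Definition hadamard (R : realType) (n : nat) (alpha : R) (j : 'I_n)
    (u : 'rV[R]_n -> R) (x : 'rV[R]_n) : R :=
  (Gamma (1 - alpha))^-1 * (x 0 j *
    partial j (fun y : 'rV[R]_n =>
      \int[@lebesgue_measure R]_(s in `[1, y 0 j])
        (ln (y 0 j / s) `^ (- alpha) * u (set_coord y j s) / s)) x).

Definition box (R : realType) (n : nat) (h : 'I_n -> R) : set 'rV[R]_n :=
  [set x | forall j, 1 < x 0 j < h j].

(* Main.v *)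
Require Import Defs.
From HB Require Import structures.
From mathcomp Require Import all_boot all_order all_algebra.
From mathcomp Require Import all_classical all_reals all_analysis.
From mathcomp Require Import measurable_realfun ring lra.
Import Order.TTheory GRing.Theory Num.Theory.
Import numFieldNormedType.Exports.
Local Open Scope classical_set_scope.
Local Open Scope ring_scope.

(** The principle holds because at an interior positive maximum every term on
    the left-hand side of the equation is nonpositive and the fractional terms
    are strictly negative. Indeed, let [u] attain its maximum over the closed box at
    an interior point [x] with [u x > 0]. The first partial derivatives vanish,
    the pure second ones are nonpositive, [c x * u x <= 0], and each Hadamard
    derivative of [u] at [x] is positive, so that its product with [b j x < 0]
    is negative. The sum is then negative, against [F >= 0]. If the
    maximum is not positive, or is attained on the boundary, there is nothing
    to prove; both maxima exist by compactness.

    The substance is the positivity of the Hadamard derivative at a maximum. In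
    one variable it is, up to positive factors, the derivative at [x] of
    [I y = int_1^y (ln (y/s))^(-alpha) w s ds/s].

    The derivative has to be shown to exist, since the kernel is singular
    at the moving endpoint. The substitution [t = (ln (y/s))^(1-alpha)] turns
    the singular measure into a multiple of [dt] and gives
    [I y = (1-alpha)^-1 int_0^T(y) w (y exp (- t^(1/(1-alpha)))) dt] with
    [T(y) = (ln y)^(1-alpha)] ([Rintegral_hadamard_logwarp]). Extending [w] by
    the constant [w 1] to the left of the base point makes the range of [t]
    independent of [y], up to an explicit correction, and dominated convergence
    applies because [w] is Lipschitz ([derivable_hadamard_integral]).

    For its sign, subtract the value at the maximum: [w s = w x - p s] with
    [p >= 0] and [p x = 0]. The constant contributes [w x * (ln x)^(-alpha) / x],
    which is positive because [w x > 0]. As the kernel decreases in [y] and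
    [p s <= L (x - s)], the contribution of [p] to [I x - I y] for [y < x]
    is at least [- L (x - y) (ln (x/y))^(1-alpha) / (1-alpha)], which is
    [o (x - y)] ([hadamard_gap_le], [hadamard_integral_derive_max]). *)

Set Implicit Arguments.
Unset Strict Implicit.
Unset Printing Implicit Defensive.

(** * Convergence of integrals *)

Section integral_convergence.
Context {R : realType}.

(** Monotone convergence, in the form that proves integrability of a nonnegative
    singular integrand from uniform bounds away from the singularity. *)
Lemma ge0_integral_bigcup_le d (T : measurableType d)
    (m : {measure set T -> \bar R}) (F : (set T)^nat) (f : T -> \bar R)
    (C : \bar R) :
  nondecreasing_seq F -> (forall i, measurable (F i)) ->
  (forall i, measurable_fun (F i) f) -> (forall i x, F i x -> 0 <= f x)%E ->
  (forall i, \int[m]_(x in F i) f x <= C)%E ->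
  (\int[m]_(x in \bigcup_i F i) f x <= C)%E.
Proof.
move=> ndF mF mf f0 fC.
have /(cvg_lim (@ereal_hausdorff R)) <- :=
  ge0_nondecreasing_set_cvg_integral (mu := m) ndF mF mf f0.
have nd : nondecreasing_seq (fun i => \int[m]_(x in F i) f x)%E.
  exact: ge0_nondecreasing_set_nondecreasing_integral.
apply: lime_le; last exact: nearW.
exact: ereal_nondecreasing_is_cvgn nd.
Qed.

(** Differentiation under the integral sign by dominated convergence.
    Differentiability is required at the point [a] only, with a Lipschitz bound
    for the domination; this is what the truncated functions below satisfy,
    since their kink sits at a value of the integration variable that moves with
    the parameter. *)
Lemma derivable_Rintegral_lipschitz d (Y : measurableType d)
    (m : {measure set Y -> \bar R}) (B : set Y) (f : R -> Y -> R)
    (G : Y -> R) (a : R) :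
  measurable B -> (forall x, m.-integrable B (EFin \o f x)) ->
  m.-integrable B (EFin \o G) ->
  (forall x y, B y -> `|f x y - f a y| <= G y * `|x - a|) ->
  (forall y, B y -> derivable (f ^~ y) a 1) ->
  derivable (fun x => \int[m]_(y in B) f x y) a 1.
Proof.
move=> mB intf intG fG df.
apply/cvg_ex; exists (\int[m]_(y in B) 'D_1 (f ^~ y) a).
apply/cvgr_dnbhsP => t [t0 t_cvg0].
pose g n y : R := (t n)^-1 * (f (t n + a) y - f a y).
have ig n : m.-integrable B (EFin \o g n).
  have := integrableZl mB (t n)^-1 (integrableB mB (intf (t n + a)) (intf a)).
  by apply: eq_integrable => // y _ /=; rewrite -EFinB -EFinM.
have mg n : measurable_fun B (EFin \o g n) by exact: measurable_int (ig n).
have gG : forall n y, B y -> (`|(EFin \o g n) y| <= (EFin \o G) y)%E.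
  move=> n y By; rewrite /= lee_fin normrM normfV ler_pdivrMl ?normr_gt0//.
  by rewrite mulrC; have := fG (t n + a) y By; rewrite addrK.
have gD y : B y -> (EFin \o g ^~ y) n @[n --> \oo] --> ('D_1 (f ^~ y) a)%:E.
  move=> By; apply: cvg_EFin; first exact: nearW.
  have /cvgr_dnbhsP/(_ t (conj t0 t_cvg0)) :
    h^-1 *: (f (h *: 1 + a) y - f a y) @[h --> 0^']
      --> 'D_1 (f ^~ y) a := df y By.
  apply: cvg_trans; apply: near_eq_cvg; apply: nearW => n /=.
  by rewrite /g [t n *: 1]mulr1.
have mD : measurable_fun B (fun y => ('D_1 (f ^~ y) a)%:E).
  by apply: emeasurable_fun_cvg gD => k; exact: mg.
have [intD _ cvD] := @dominated_convergence _ _ _ m _ mB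
  (fun n => EFin \o g n) _ (EFin \o G) mg mD (aeW _ gD) intG
  (aeW _ (fun y n By => gG n y By)).
have : \int[m]_(y in B) g n y @[n --> \oo]
    --> \int[m]_(y in B) 'D_1 (f ^~ y) a.
  apply: fine_cvg; rewrite /Rintegral fineK; first exact: cvD.
  exact: integrable_fin_num intD.
apply: cvg_trans; apply: near_eq_cvg; apply: nearW => n /=.
rewrite [t n *: 1]mulr1 /g RintegralZl//; last first.
  by apply: eq_integrable (integrableB mB (intf (t n + a)) (intf a)).
by rewrite RintegralB.
Qed.

End integral_convergence.

(** * Auxiliary facts of real analysis *)

Section real_analysis.
Context {R : realType}.
Implicit Types (alpha x y s t L a b : R) (v w : R -> R).

Lemma is_derive_continuous (f : R -> R) (x d : R) :
  is_derive x 1 f d -> {for x, continuous f}.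
Proof. by move=> [df _]; apply/differentiable_continuous/derivable1_diffP. Qed.

Lemma derivable1_comp (f g : R -> R) x d : derivable f (g x) 1 ->
  is_derive x 1 g d -> derivable (fun y => f (g y)) x 1.
Proof.
move=> /derivableP df dg.
by have [] := @is_derive1_comp _ f g x _ _ df dg.
Qed.

Lemma is_derive_lincomb (f g : R -> R) (c a b x : R) :
  is_derive x 1 f a -> is_derive x 1 g b ->
  is_derive x 1 (fun y => c * f y - g y) (c * a - b).
Proof. by move=> df dg; apply: is_derive_eq. Qed.

Lemma derivable_affine_comb (f g : R -> R) (b k c x : R) :
  derivable f x 1 -> derivable g x 1 ->
  derivable (fun y => b * (f y - (k - g y) * c)) x 1.
Proof.
by move=> /derivableP df /derivableP dg; exact: ex_derive.
Qed.

Lemma is_derive_ln_powR y p : 1 < y ->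
  is_derive y 1 (fun y => ln y `^ p) (p * ln y `^ (p - 1) * y^-1).
Proof.
move=> y1; have y0 : 0 < y by exact: lt_trans y1.
exact: (@is_derive1_comp _ (fun z => z `^ p) (@ln R) y _ _
  (is_derive1_powR p (ln_gt0 y1)) (is_derive1_ln y0)).
Qed.

Lemma ln_div_le x y : 1 < y -> y <= x -> ln (x / y) <= x - y.
Proof.
move=> y1 yx; have y0 : 0 < y by exact: lt_trans y1.
have -> : x / y = 1 + (x - y) / y by field; rewrite gt_eqF.
apply: (@le_trans _ _ ((x - y) / y)).
  apply: le_ln1Dx; rewrite (lt_le_trans (ltrN10 _))//.
  by rewrite divr_ge0 ?subr_ge0// ltW.
by rewrite ler_pdivrMr// ler_peMr ?subr_ge0// ltW.
Qed.

Lemma lipschitz_continuous v L :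
  (forall s t, `|v s - v t| <= L * `|s - t|) -> continuous v.
Proof.
move=> vL s; apply/cvgrPdist_le => e e0.
have L0 : 0 < `|L| + 1 by rewrite ltr_wpDl.
near=> t.
apply: (le_trans (vL s t)); apply: (@le_trans _ _ ((`|L| + 1) * `|s - t|)).
  by rewrite ler_wpM2r// (le_trans (ler_norm L))// lerDl.
rewrite -ler_pdivlMl//; near: t.
by apply: cvgr_dist_le; [exact: cvg_id|rewrite mulr_gt0// invr_gt0].
Unshelve. all: by end_near. Qed.

Lemma continuous_bounded_itv w a b : continuous w ->
  exists2 C, 0 < C & forall s, a <= s <= b -> `|w s| <= C.
Proof.
move=> cw.
have /compact_bounded/ex_strict_bound_gt0[C C0 /= wC] :
    compact (w @` `[a, b]%classic).
  apply: continuous_compact (@segment_compact _ a b).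
  exact: continuous_subspaceT.
by exists C => // s sab; rewrite ltW//; apply: wC; exists s.
Qed.

Lemma bounded_derive_lipschitz w a b L :
  {within `[a, b], continuous w} ->
  (forall s, s \in `]a, b[ -> derivable w s 1) ->
  (forall s, s \in `]a, b[ -> `|'D_1 w s| <= L) ->
  {in `[a, b] &, forall s t, `|w s - w t| <= L * `|s - t|}.
Proof.
move=> cw dw wL.
have le s t : s \in `[a, b] -> t \in `[a, b] -> s < t ->
    `|w t - w s| <= L * `|t - s|.
  rewrite !in_itv/= => /andP[sa sb] /andP[ta tb] st.
  have sub r : r \in `]s, t[ -> r \in `]a, b[.
    rewrite !in_itv/= => /andP[sr rt].
    by rewrite (le_lt_trans sa)//= (lt_le_trans rt).
  have sub2 : `[s, t] `<=` `[a, b] by apply: subset_itv; rewrite bnd_simp.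
  have [r rst ->] := @MVT _ w ('D_1 w) s t st
    (fun r rst => DeriveDef (dw r (sub r rst)) erefl)
    (continuous_subspaceW sub2 cw).
  by rewrite normrM ler_wpM2r// wL// sub.
move=> s t sab tab; have [st|ts|->] := ltgtP s t.
- by rewrite distrC [`|s - t|]distrC; exact: le.
- exact: le.
- by rewrite !subrr normr0 mulr0.
Qed.

Lemma clamp_in a b s : a <= b -> Num.max a (Num.min s b) \in `[a, b].
Proof.
by move=> ab; rewrite in_itv/= le_max lexx/= ge_max ab ge_min lexx orbT.
Qed.

Lemma clamp_id a b s : a <= s <= b -> Num.max a (Num.min s b) = s.
Proof. by move=> /andP[sa sb]; rewrite min_l// max_r. Qed.

(** Truncation to [[a, b]] is a contraction, so that precomposition with it
    extends a Lipschitz function on [[a, b]] to the whole line with the same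
    constant. *)
Lemma clamp_dist a b s t :
  `|Num.max a (Num.min s b) - Num.max a (Num.min t b)| <= `|s - t|.
Proof.
wlog st : s t / s <= t => [H|].
  have [|/ltW ts] := leP s t; first exact: H.
  by rewrite [leLHS]distrC [leRHS]distrC; exact: H.
have h1 : Num.max a (Num.min s b) <= Num.max a (Num.min t b).
  by rewrite ge_max le_max lexx/= le_max le_min !ge_min st lexx !orbT.
rewrite [leLHS]distrC [leRHS]distrC !ger0_norm ?subr_ge0//.
have d0 : 0 <= t - s by rewrite subr_ge0.
rewrite lerBlDr ge_max; apply/andP; split.
  by rewrite -[leLHS]add0r lerD// le_max lexx.
apply: (@le_trans _ _ (t - s + Num.min s b)).
  by rewrite addr_minr subrK le_min !ge_min lexx/= lerDr d0 orbT.
by rewrite lerD2l le_max lexx orbT.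
Qed.

(** If the second derivative were positive, the first one, which vanishes at
    [c], would be positive just to the right of [c], and the mean value theorem
    would give larger values of [w] there. *)
Lemma second_derivative_max w a b c : a < c -> c < b ->
  (forall s, s \in `]a, b[ -> derivable w s 1) ->
  derivable ('D_1 w) c 1 -> (forall s, s \in `]a, b[ -> w s <= w c) ->
  'D_1 w c = 0 /\ 'D_1 ('D_1 w) c <= 0.
Proof.
move=> ac cb dw ddw wmax.
have cab : c \in `]a, b[ by rewrite in_itv/= ac.
have D0 : 'D_1 w c = 0.
  by have [_ ->] := derive1_at_max (ltW (lt_trans ac cb)) dw cab wmax.
split => //; rewrite leNgt; apply/negP => D2.
have H : h^-1 *: ('D_1 w (h *: 1 + c) - 'D_1 w c) @[h --> 0^'+]
    --> 'D_1 ('D_1 w) c.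
  exact: cvg_dnbhs_at_right ddw.
have H0 := cvgr_gt _ H _ D2.
have [e /= e0 He] : exists2 e, 0 < e &
    forall h, 0 < h -> h < e -> 0 < 'D_1 w (h + c).
  case: H0 => e /= e0 He; exists e => // h h0 he.
  have := He h; rewrite /= sub0r normrN gtr0_norm// => /(_ he h0).
  by rewrite D0 subr0 [h *: 1]mulr1 /GRing.scale/= pmulr_rgt0// invr_gt0.
pose d := Num.min (e / 2) ((b - c) / 2).
have d0 : 0 < d by rewrite lt_min !divr_gt0// subr_gt0.
have de : d < e by rewrite gt_min ltr_pdivrMr// ltr_pMr// ltr1n.
have db : c + d < b.
  rewrite -ltrBrDl gt_min; apply/orP; right.
  by rewrite ltr_pdivrMr// ltr_pMr ?subr_gt0// ltr1n.
have cd : c < c + d by rewrite ltrDl.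
have sub r : r \in `[c, c + d] -> r \in `]a, b[.
  rewrite !in_itv/= => /andP[cr rd].
  by rewrite (lt_le_trans ac)//= (le_lt_trans rd).
have subo r : r \in `]c, c + d[ -> r \in `]a, b[.
  by move=> rcd; apply: sub; exact: subset_itv_oo_cc.
have [r rcd E] := @MVT _ w ('D_1 w) c (c + d) cd
  (fun r rst => DeriveDef (dw r (subo r rst)) erefl)
  (derivable_within_continuous (fun r rcd => dw r (sub r rcd))).
have := wmax (c + d); rewrite -subr_le0 E leNgt => /(_ _)/negP; apply.
  by rewrite in_itv/= (lt_trans ac).
rewrite mulr_gt0 ?subr_gt0//.
move: rcd; rewrite in_itv/= => /andP[cr rd].
rewrite -(subrK c r); apply: He; first by rewrite subr_gt0.
by rewrite ltrBlDl (lt_trans rd)// ltrD2l.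
Qed.

End real_analysis.

(** * Desingularisation of the Hadamard kernel *)

(** The substitution [s = y exp (- t^(1/(1-alpha)))], inverse of
    [t = (ln (y/s))^(1-alpha)]: it turns the singular measure
    [(ln (y/s))^(-alpha) ds/s] into the constant multiple [dt/(1-alpha)], and it
    depends on [y] only through a factor. *)
Definition logwarp {R : realType} (alpha y t : R) : R :=
  y * expR (- (t `^ (1 - alpha)^-1)).

Section change_of_variables.
Context {R : realType}.
Implicit Types (alpha y c s t e : R) (w : R -> R).
Notation mu := (@lebesgue_measure R).

Lemma is_derive_logwarp alpha y t : 0 < t ->
  is_derive t 1 (logwarp alpha y)
    (- (logwarp alpha y t * ((1 - alpha)^-1 * t `^ ((1 - alpha)^-1 - 1)))).
Proof.
move=> t0; rewrite /logwarp.
have d1 := is_derive1_powR (1 - alpha)^-1 t0.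
by apply: is_derive_eq; rewrite /GRing.scale/= !mulrN mulrA.
Qed.

Lemma continuous_logwarp_derive alpha y t : 0 < t ->
  {for t, continuous (logwarp alpha y)^`()%classic}.
Proof.
move=> t0.
pose f (s : R) : R :=
  - (1 - alpha)^-1 * logwarp alpha y s * s `^ ((1 - alpha)^-1 - 1).
have E (s : R) : 0 < s -> (logwarp alpha y)^`()%classic s = f s.
  move=> s0; rewrite derive1E; have [_ ->] := is_derive_logwarp alpha y s0.
  by rewrite /f; ring.
have cf : {for t, continuous f}.
  apply: cvgM.
    apply: cvgM; first exact: cvg_cst.
    exact: is_derive_continuous (is_derive_logwarp alpha y t0).
  exact: is_derive_continuous (is_derive1_powR ((1 - alpha)^-1 - 1) t0).
rewrite /prop_for /continuous_at E//.
apply: cvg_trans cf; apply: near_eq_cvg; near=> s; rewrite E//.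
by near: s; exact: lt_nbhsr.
Unshelve. all: by end_near. Qed.

Lemma logwarp_lt alpha y s t : alpha < 1 -> 0 < y -> 0 <= s -> s < t ->
  logwarp alpha y t < logwarp alpha y s.
Proof.
move=> a1 y0 s0 st; rewrite /logwarp ltr_pM2l// ltr_expR ltrN2.
apply: gt0_ltr_powR => //; rewrite ?invr_gt0 ?subr_gt0// nnegrE.
exact: le_trans (ltW st).
Qed.

Lemma logwarp_gt0 alpha y t : 0 < y -> 0 < logwarp alpha y t.
Proof. by move=> y0; rewrite mulr_gt0// expR_gt0. Qed.

Lemma logwarp_le alpha y t : 0 < y -> logwarp alpha y t <= y.
Proof.
by move=> y0; rewrite ger_pMr// expR_le1 oppr_le0 powR_ge0.
Qed.

Lemma norm_logwarp_le alpha y t : `|logwarp alpha y t| <= `|y|.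
Proof.
rewrite normrM ler_piMr// ger0_norm ?expR_ge0// expR_le1 oppr_le0.
exact: powR_ge0.
Qed.

Lemma logwarp0 alpha y : alpha < 1 -> logwarp alpha y 0 = y.
Proof.
move=> a1; rewrite /logwarp powR0 ?oppr0 ?expR0 ?mulr1//.
by rewrite invr_neq0// gt_eqF// subr_gt0.
Qed.

Lemma logwarp_eqM alpha y t : logwarp alpha y t = y * logwarp alpha 1 t.
Proof. by rewrite /logwarp mul1r. Qed.

Lemma ln_logwarp alpha y t : 0 < y ->
  ln (y / logwarp alpha y t) = t `^ (1 - alpha)^-1.
Proof.
move=> y0; rewrite /logwarp invfM mulrA mulfV ?gt_eqF// mul1r -expRN opprK.
by rewrite expRK.
Qed.

Lemma logwarp_ln alpha y c : alpha < 1 -> 0 < c -> c <= y ->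
  logwarp alpha y (ln (y / c) `^ (1 - alpha)) = c.
Proof.
move=> a1 c0 cy; have y0 := lt_le_trans c0 cy.
rewrite /logwarp -powRrM mulfV ?gt_eqF ?subr_gt0// powRr1; last first.
  by rewrite ln_ge0// ler_pdivlMr// mul1r.
by rewrite expRN lnK ?posrE ?divr_gt0// invf_div mulrCA mulfV ?mulr1 ?gt_eqF.
Qed.

Lemma logwarp_ltE alpha y c t : alpha < 1 -> 0 < c -> c <= y -> 0 <= t ->
  (logwarp alpha y t < c) = (ln (y / c) `^ (1 - alpha) < t).
Proof.
move=> a1 c0 cy t0; have y0 := lt_le_trans c0 cy.
rewrite -{1}(logwarp_ln a1 c0 cy).
apply/idP/idP; last by apply: logwarp_lt => //; exact: powR_ge0.
apply: contraTT; rewrite -!leNgt le_eqVlt => /predU1P[->//|tT].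
by rewrite ltW// logwarp_lt.
Qed.

Lemma logwarp_cvg0 alpha y : alpha < 1 ->
  logwarp alpha y t @[t --> 0^'+] --> logwarp alpha y 0.
Proof.
move=> a1; rewrite logwarp0//.
have b0 : 0 < (1 - alpha)^-1 by rewrite invr_gt0 subr_gt0.
have h : - (t `^ (1 - alpha)^-1) @[t --> 0^'+] --> (0 : R).
  by rewrite -[X in _ --> X]oppr0; apply: cvgN (powR_cvg0 b0).
have h1 : expR (- (t `^ (1 - alpha)^-1)) @[t --> 0^'+] --> (1 : R).
  rewrite -[X in _ --> X](expR0 R).
  exact: (@cvg_comp _ _ _ _ (@expR R) _ _ _ h (@continuous_expR R 0)).
by rewrite -[X in _ --> X]mulr1; apply: cvgM h1; exact: cvg_cst.
Qed.

Lemma measurable_logwarp alpha y : measurable_fun [set: R] (logwarp alpha y).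
Proof.
apply: measurable_funM => //; apply: measurableT_comp => //.
by apply: measurableT_comp => //; exact: measurable_powR.
Qed.

(** The exponents of [t] cancel: [-alpha/(1-alpha) + 1/(1-alpha) - 1 = 0]. *)
Lemma hadamard_kernel_logwarp alpha y t v : 0 < alpha < 1 -> 0 < y -> 0 < t ->
  ln (y / logwarp alpha y t) `^ (- alpha) * v / logwarp alpha y t
  * (logwarp alpha y t * ((1 - alpha)^-1 * t `^ ((1 - alpha)^-1 - 1))) =
  (1 - alpha)^-1 * v.
Proof.
move=> /andP[a0 a1] y0 t0; rewrite ln_logwarp//.
have := logwarp_gt0 alpha t y0; set l := logwarp _ _ _ => l0.
rewrite -powRrM.
transitivity ((1 - alpha)^-1 * v *
    (t `^ ((1 - alpha)^-1 * - alpha) * t `^ ((1 - alpha)^-1 - 1))).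
  by field; rewrite subr_eq0 !gt_eqF.
rewrite -powRD; last by rewrite (gt_eqF t0) implybT.
have -> : (1 - alpha)^-1 * - alpha + ((1 - alpha)^-1 - 1) = 0.
  by field; rewrite subr_eq0 gt_eqF.
by rewrite powRr0 mulr1.
Qed.

Lemma continuous_hadamard_kernel alpha y s w : 0 < s -> s < y -> continuous w ->
  {for s, continuous (fun s : R => ln (y / s) `^ (- alpha) * w s / s)}.
Proof.
move=> s0 sy cw.
have ys : 1 < y / s by rewrite ltr_pdivlMr// mul1r.
have ci : {for s, continuous (fun s : R => s^-1)}.
  by apply: cvgV; [rewrite gt_eqF|exact: cvg_id].
apply: cvgM; last exact: ci.
apply: cvgM; last exact: cw.
have c1 : (y / t) @[t --> s] --> y / s.
  by apply: cvgM; [exact: cvg_cst|exact: ci].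
have c2 : ln t @[t --> y / s] --> ln (y / s).
  by apply: continuous_ln; rewrite divr_gt0// (lt_trans s0).
have c3 := is_derive_continuous (is_derive1_powR (- alpha) (ln_gt0 ys)).
apply: (@cvg_comp _ _ _ (fun t => y / t) (fun z => ln z `^ (- alpha)) _ _ _ c1).
exact: (@cvg_comp _ _ _ (@ln R) (fun z => z `^ (- alpha)) _ _ _ c2).
Qed.

(** The change of variables away from the singularity [s = y], that is for
    [t >= e > 0], where everything is continuous. *)
Lemma integral_hadamard_logwarp_eps alpha y c e w :
  0 < alpha < 1 -> 0 < c -> c < y -> continuous w ->
  0 < e <= ln (y / c) `^ (1 - alpha) ->
  (\int[mu]_(s in `[c, logwarp alpha y e])
     (ln (y / s) `^ (- alpha) * w s / s)%:E =
   \int[mu]_(t in `[e, (ln (y / c) `^ (1 - alpha))%R])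
     ((1 - alpha)^-1 * w (logwarp alpha y t))%:E)%E.
Proof.
move=> /[dup] a01 /andP[a0 a1] c0 cy cw /andP[e0 eT].
have y0 := lt_trans c0 cy.
have cl t : 0 < t -> {for t, continuous (logwarp alpha y)}.
  by move=> t0; exact: is_derive_continuous (is_derive_logwarp alpha y t0).
have T0 := lt_le_trans e0 eT.
rewrite -[X in (`[X, _])](@logwarp_ln alpha y c)// ?ltW//.
set T := ln (y / c) `^ (1 - alpha) in eT T0 *.
rewrite integration_by_substitution_decreasing//.
- apply: eq_integral => t; rewrite inE/= in_itv/= => /andP[et tT]; congr EFin.
  have t0 := lt_le_trans e0 et.
  rewrite !fctE derive1E.
  have [_ ->] := is_derive_logwarp alpha y t0; rewrite opprK.
  exact: hadamard_kernel_logwarp.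
- move=> s t; rewrite !in_itv/= => /andP[es sT] /andP[et tT] st.
  by apply: logwarp_lt => //; exact: ltW (lt_le_trans e0 et).
- move=> t; rewrite in_itv/= => /andP[et tT]; apply: continuous_logwarp_derive.
  exact: lt_trans et.
- apply: cvgP; apply: cvg_at_right_filter; exact: continuous_logwarp_derive.
- apply: cvgP; apply: cvg_at_left_filter; exact: continuous_logwarp_derive.
- split.
  + move=> t; rewrite in_itv/= => /andP[et tT].
    by have [] := is_derive_logwarp alpha y (lt_trans e0 et).
  + by apply: cvg_at_right_filter; exact: cl.
  + by apply: cvg_at_left_filter; exact: cl.
- apply: continuous_in_subspaceT => s; rewrite inE/= in_itv/= => /andP[Ts se].
  apply: continuous_hadamard_kernel => //.
    by apply: lt_le_trans Ts; exact: logwarp_gt0.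
  apply: le_lt_trans se _.
  by rewrite -[ltRHS](@logwarp0 alpha)//; exact: logwarp_lt.
Qed.

Lemma itvco_bigcup_logwarp alpha y c (T : R) :
  alpha < 1 -> 0 < c -> c < y -> 0 < T ->
  `[c, y[ `<=` \bigcup_n `[c, logwarp alpha y (T / n.+1%:R)]%classic.
Proof.
move=> a1 c0 cy T0 s /=; rewrite in_itv/= => /andP[cs sy].
have y0 := lt_trans c0 cy; have s0 := lt_le_trans c0 cs.
set S := ln (y / s) `^ (1 - alpha).
have S0 : 0 < S by rewrite powR_gt0// ln_gt0// ltr_pdivlMr// mul1r.
have [n _ nS] := near_infty_natSinv_lt (PosNum (divr_gt0 S0 T0)).
exists n => //=; rewrite in_itv/= cs/= -[leLHS](@logwarp_ln alpha y s) ?ltW//.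
apply: logwarp_lt => //; first by rewrite divr_ge0// ltW.
by have := nS n (leqnn n); rewrite /= ltr_pdivlMr// mulrC.
Qed.

Lemma measurable_hadamard_integrand alpha y c w : 0 < c -> continuous w ->
  measurable_fun `[c, y] (fun s => ln (y / s) `^ (- alpha) * w s / s).
Proof.
move=> c0 cw; apply/measurable_fun_itv_bndo_bndcP.
apply: (@measurable_funS _ _ _ _ `]0, y[) => //.
  by apply: subset_itvr; rewrite bnd_simp.
apply: open_continuous_measurable_fun; first exact: interval_open.
move=> s; rewrite inE/= in_itv/= => /andP[s0 sy].
exact: continuous_hadamard_kernel.
Qed.

(** By the change of variables the integral over [[c, y']], for [y' < y], is at
    most [(ln (y/c))^(1-alpha)/(1-alpha)]. The factor [1] makes this the case
    [w = 1] of the integrand used below. *)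
Lemma integrable_hadamard_kernel alpha y c : 0 < alpha < 1 -> 0 < c -> c < y ->
  mu.-integrable `[c, y] (EFin \o (fun s => ln (y / s) `^ (- alpha) * 1 / s)).
Proof.
move=> /[dup] a01 /andP[a0 a1] c0 cy; have y0 := lt_trans c0 cy.
have mk :=
  @measurable_hadamard_integrand alpha y c _ c0 (@cst_continuous R R 1).
have k0 s : c <= s -> 0 <= ln (y / s) `^ (- alpha) * 1 / s.
  by move=> cs; rewrite mulr1 divr_ge0 ?powR_ge0// (le_trans (ltW c0)).
apply/integrableP; split; first exact/measurable_EFinP.
rewrite [ltLHS](_ : _ = \int[mu]_(s in `[c, y])
    (ln (y / s) `^ (- alpha) * 1 / s)%:E)%E; last first.
  apply: eq_integral => s; rewrite inE/= in_itv/= => /andP[cs _].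
  by rewrite ger0_norm ?k0.
rewrite -integral_itv_bndo_bndc; last first.
  apply/measurable_EFinP; apply: measurable_funS mk => //.
  by apply: subset_itvl; rewrite bnd_simp.
set T := ln (y / c) `^ (1 - alpha).
have T0 : 0 < T by rewrite powR_gt0// ln_gt0// ltr_pdivlMr// mul1r.
have Fy n : logwarp alpha y (T / n.+1%:R) <= y.
  rewrite -[leRHS](@logwarp0 alpha)// ltW// logwarp_lt//.
  by rewrite divr_gt0.
have mF n : measurable_fun `[c, logwarp alpha y (T / n.+1%:R)]
    (fun s => (ln (y / s) `^ (- alpha) * 1 / s)%:E).
  apply/measurable_EFinP; apply: measurable_funS mk => //.
  by apply: subset_itvl; rewrite bnd_simp.
apply: (@le_lt_trans _ _ ((1 - alpha)^-1 * T)%:E); last by rewrite ltry.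
apply: (@le_trans _ _ (\int[mu]_(s in
    \bigcup_n `[c, logwarp alpha y (T / n.+1%:R)]%classic)
    (ln (y / s) `^ (- alpha) * 1 / s)%:E)%E).
  apply: ge0_subset_integral => //.
  - exact: bigcup_measurable.
  - exact/measurable_fun_bigcup.
  - by move=> s [n _ /=]; rewrite in_itv/= lee_fin => /andP[/k0].
  - exact: itvco_bigcup_logwarp.
apply: (ge0_integral_bigcup_le (m := mu)
  (F := fun n => `[c, logwarp alpha y (T / n.+1%:R)]%classic)).
- move=> m n mn; rewrite subsetEset; apply: subset_itvl; rewrite bnd_simp.
  move: mn; rewrite leq_eqVlt => /predU1P[->//|mn].
  rewrite ltW// logwarp_lt ?divr_ge0// ?(ltW T0)//.
  by rewrite ltr_pM2l// ltf_pV2 ?posrE// ltr_nat.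
- by move=> n; exact: measurable_itv.
- exact: mF.
- by move=> n s /=; rewrite in_itv/= lee_fin => /andP[/k0].
move=> n.
have e0 : 0 < T / n.+1%:R by rewrite divr_gt0.
have eT : T / n.+1%:R <= T by rewrite ler_pdivrMr// ler_peMr ?(ltW T0)// ler1n.
rewrite (@integral_hadamard_logwarp_eps alpha y c _ (cst 1))//; last 2 first.
  by move=> ?; exact: cvg_cst.
  by rewrite e0.
rewrite (eq_integral (cst ((1 - alpha)^-1)%:E)); last first.
  by move=> s _; rewrite /= mulr1.
rewrite integral_cst//= lebesgue_measure_itv/= lte_fin.
case: ifPn => _; last first.
  by rewrite mule0 lee_fin mulr_ge0 ?(ltW T0)// invr_ge0 subr_ge0 ltW.
rewrite -EFinD -EFinM lee_fin ler_wpM2l ?invr_ge0 ?subr_ge0 ?(ltW a1)//.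
by rewrite gerBl ltW.
Qed.

Lemma integrable_hadamard_integrand alpha y c w :
  0 < alpha < 1 -> 0 < c -> c < y -> continuous w ->
  mu.-integrable `[c, y] (EFin \o (fun s => ln (y / s) `^ (- alpha) * w s / s)).
Proof.
move=> a01 c0 cy cw.
have bw : [bounded w s | s in `[c, y]%classic].
  have /compact_bounded[M [Mr Mw]] : compact (w @` `[c, y]%classic).
    apply: continuous_compact (@segment_compact _ c y).
    exact: continuous_subspaceT.
  by exists M; split => // N MN s sy; apply: (Mw _ MN); exists s.
have ik := integrable_hadamard_kernel a01 c0 cy.
have mw : measurable_fun `[c, y]%classic w.
  exact: measurable_funTS (continuous_measurable_fun cw).
apply: eq_integrable (integrableMl _ ik mw bw) => // s _ /=.
by rewrite -EFinM mulr1 mulrAC.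
Qed.

Lemma integrable_comp_logwarp alpha y T w : continuous w ->
  mu.-integrable `[0, T] (EFin \o (fun t => w (logwarp alpha y t))).
Proof.
move=> cw; apply: measurable_bounded_integrable => //.
- by rewrite /= lebesgue_measure_itv/=; case: ifP => // _; rewrite -EFinD ltry.
- apply: measurable_funTS.
  apply: measurableT_comp (@measurable_logwarp alpha y).
  exact: continuous_measurable_fun.
- have [C C0 wC] := continuous_bounded_itv (- `|y|) `|y| cw.
  exists C; split; first exact: num_real.
  move=> N CN t _ /=; apply: le_trans (ltW CN); apply: wC.
  by rewrite -ler_norml norm_logwarp_le.
Qed.

(** Letting [e] tend to [0] in the regular case; both sides converge because
    both integrands are integrable. *)
Lemma Rintegral_hadamard_logwarp alpha y c w :
  0 < alpha < 1 -> 0 < c -> c < y -> continuous w ->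
  \int[mu]_(s in `[c, y]) (ln (y / s) `^ (- alpha) * w s / s) =
  (1 - alpha)^-1 *
    \int[mu]_(t in `[0, ln (y / c) `^ (1 - alpha)]) w (logwarp alpha y t).
Proof.
move=> /[dup] a01 /andP[a0 a1] c0 cy cw; have y0 := lt_trans c0 cy.
set T := ln (y / c) `^ (1 - alpha).
have T0 : 0 < T by rewrite powR_gt0// ln_gt0// ltr_pdivlMr// mul1r.
have ik := integrable_hadamard_integrand a01 c0 cy cw.
have iw := integrable_comp_logwarp alpha y T cw.
set k := fun s => ln (y / s) `^ (- alpha) * w s / s.
set g := fun t => w (logwarp alpha y t).
have lhs : \int[mu]_(s in `[c, logwarp alpha y e]) k s @[e --> 0^'+]
    --> \int[mu]_(s in `[c, y]) k s.
  have H : parameterized_integral mu c s k @[s --> (logwarp alpha y 0)^'-]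
      --> \int[mu]_(s in `[c, y]) k s.
    by rewrite logwarp0//; exact: parameterized_integral_cvg_at_left.
  have := @decreasing_cvg_at_right_comp R (logwarp alpha y)
    (parameterized_integral mu c ^~ k) 0 +oo%O _ _ _ _ H.
  apply => //.
    move=> s t; rewrite !in_itv/= !andbT => s0 t0 st.
    exact: logwarp_lt.
  exact: logwarp_cvg0.
have rhs : (1 - alpha)^-1 * (\int[mu]_(t in `[0, T]) g t -
    \int[mu]_(t in `[0, e]) g t) @[e --> 0^'+] -->
    (1 - alpha)^-1 * \int[mu]_(t in `[0, T]) g t.
  apply: cvgM; first exact: cvg_cst.
  rewrite -[X in _ --> X]subr0; apply: cvgB; first exact: cvg_cst.
  apply: cvg_at_right_filter.
  exact: (parameterized_integral_cvg_left T0 iw).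
rewrite -(cvg_lim (@Rhausdorff R) lhs); apply/cvg_lim; first exact: Rhausdorff.
apply: cvg_trans rhs; apply: near_eq_cvg; near=> e.
have e0 : 0 < e by near: e; exact: nbhs_right_gt.
have eT : e <= T by near: e; exact: nbhs_right_le.
rewrite Rintegral_itvB// ?bnd_simp// ?ltW//.
rewrite Rintegral_itv_obnd_cbnd; last first.
  by apply: integrableS iw => //; apply: subset_itvr; rewrite bnd_simp ltW.
rewrite -RintegralZl//; last first.
  by apply: integrableS iw => //; apply: subset_itvr; rewrite bnd_simp ltW.
rewrite /Rintegral /k; congr fine; apply/esym.
by apply: integral_hadamard_logwarp_eps => //; rewrite e0.
Unshelve. all: by end_near. Qed.

Lemma Rintegral_hadamard_cst alpha y c : 0 < alpha < 1 -> 0 < c -> c < y ->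
  \int[mu]_(s in `[c, y]) (ln (y / s) `^ (- alpha) * 1 / s) =
  (1 - alpha)^-1 * ln (y / c) `^ (1 - alpha).
Proof.
move=> a01 c0 cy.
rewrite (@Rintegral_hadamard_logwarp _ _ _ (cst 1))//; last first.
  by move=> ?; exact: cvg_cst.
have T0 : 0 < ln (y / c) `^ (1 - alpha).
  by rewrite powR_gt0// ln_gt0// ltr_pdivlMr// mul1r.
congr (_ * _); rewrite Rintegral_cst//= lebesgue_measure_itv/= lte_fin T0.
by rewrite oppr0 adde0 mul1r.
Qed.

End change_of_variables.

(** * Differentiability of the Hadamard integral *)

Section differentiability.
Context {R : realType}.
Implicit Types (alpha x y h s t L : R) (v : R -> R).
Notation mu := (@lebesgue_measure R).

(** Extending the range of [t] to a bound independent of [y]: the added part has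
    [s < 1], where [v] is constant. The dependence on [y] is now carried by the
    argument of [v] and by an explicit power of [ln y]. *)
Lemma hadamard_integral_split alpha h y v : 0 < alpha < 1 -> 1 < y -> y < h ->
  continuous v -> (forall s, s <= 1 -> v s = v 1) ->
  \int[mu]_(s in `[1, y]) (ln (y / s) `^ (- alpha) * v s / s) =
  (1 - alpha)^-1 *
    (\int[mu]_(t in `[0, ln h `^ (1 - alpha)]) v (logwarp alpha y t)
     - (ln h `^ (1 - alpha) - ln y `^ (1 - alpha)) * v 1).
Proof.
move=> /[dup] a01 /andP[a0 a1] y1 yh cv v1.
have y0 : 0 < y by exact: lt_trans y1.
have h1 := lt_trans y1 yh; have h0 : 0 < h by exact: lt_trans h1.
rewrite Rintegral_hadamard_logwarp// divr1; congr (_ * _).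
set T := ln y `^ _; set K := ln h `^ _.
have TK : T < K.
  apply: gt0_ltr_powR; rewrite ?subr_gt0// ?nnegrE ?ln_ge0 ?ltW//.
  by rewrite ltr_ln ?posrE.
have T0 : 0 <= T by exact: powR_ge0.
have iv := integrable_comp_logwarp alpha y K cv.
apply/eqP; rewrite eq_sym subr_eq addrC -subr_eq; apply/eqP.
rewrite Rintegral_itvB ?bnd_simp// ?ltW//.
rewrite (@eq_Rintegral _ _ _ _ _ (cst (v 1))); last first.
  move=> t; rewrite inE/= in_itv/= => /andP[Tt _]; rewrite v1// ltW//.
  by rewrite logwarp_ltE ?divr1// ltW// (le_lt_trans T0).
by rewrite Rintegral_cst//= lebesgue_measure_itv/= lte_fin TK -EFinD/= mulrC.
Qed.

(** This is why the Hadamard derivative of a [C^1] function exists as a genuine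
    limit: after the change of variables the singular kernel is gone, and [y]
    enters through the Lipschitz function [v] and an explicit power of
    [ln y]. *)
Lemma derivable_hadamard_integral alpha h L x v : 0 < alpha < 1 ->
  1 < x -> x < h -> (forall s t, `|v s - v t| <= L * `|s - t|) ->
  (forall s, s <= 1 -> v s = v 1) ->
  (forall s, 1 < s -> s < h -> derivable v s 1) ->
  derivable (fun y => \int[mu]_(s in `[1, y])
    (ln (y / s) `^ (- alpha) * v s / s)) x 1.
Proof.
move=> /[dup] a01 /andP[a0 a1] x1 xh vL v1 dv.
have cv := lipschitz_continuous vL.
have x0 : 0 < x by exact: lt_trans x1.
have h1 := lt_trans x1 xh.
have L0 : 0 <= L.
  by have := vL 1 0; rewrite subr0 normr1 mulr1; exact: le_trans.
set T := ln x `^ (1 - alpha).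
set K := ln h `^ (1 - alpha).
(* At t = T the argument y exp(-t^(1/(1-alpha))) crosses the kink of v at 1 when
   y = x; removing this single point makes every section differentiable at x. *)
pose B := `[0, K]%classic `\ T.
pose J y := \int[mu]_(t in B) v (logwarp alpha y t).
pose S y := ln y `^ (1 - alpha).
apply: (@near_eq_derivable _ _ _
  (fun y => (1 - alpha)^-1 * (J y - (K - S y) * v 1))).
  have y1 : \forall y \near x, 1 < y by exact: lt_nbhsr.
  have yh : \forall y \near x, y < h by exact: lt_nbhsl.
  near=> y.
  have y1' : 1 < y by near: y.
  rewrite (@hadamard_integral_split _ h)//; last by near: y.
  rewrite /J /Rintegral integral_setD1//; first exact: measurableD.
  apply/measurable_EFinP; apply: measurable_funTS.
  apply: measurableT_comp (@measurable_logwarp _ alpha y).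
  exact: continuous_measurable_fun.
have dS : derivable S x 1 by have [] := is_derive_ln_powR (1 - alpha) x1.
have dJ : derivable J x 1.
  apply: (@derivable_Rintegral_lipschitz _ _ _ mu B
    (fun y t => v (logwarp alpha y t)) (cst L)).
  - exact: measurableD.
  - move=> y; apply: integrableS (integrable_comp_logwarp alpha y K cv) => //.
      exact: measurableD.
    by move=> t [].
  - have ic : mu.-integrable `[0, K] (EFin \o cst L).
      apply: continuous_compact_integrable; first exact: segment_compact.
      by apply: continuous_subspaceT => ?; exact: cvg_cst.
    apply: integrableS ic => //; first exact: measurableD.
    by move=> t [].
  - move=> y t _ /=; apply: (le_trans (vL _ _)).
    rewrite ler_wpM2l// logwarp_eqM [in leLHS](logwarp_eqM _ x) -mulrBl normrM.
    have l0 := @logwarp_gt0 _ alpha 1 t ltr01.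
    by rewrite ler_piMr// ger0_norm ?(ltW l0)//; exact: logwarp_le.
  move=> t [/=]; rewrite in_itv/= => /andP[t0 tK] tT.
  have [tT'|Tt] := ltP t T.
    have [d1 d2] : 1 < logwarp alpha x t /\ logwarp alpha x t < h.
      split; last by apply: le_lt_trans xh; exact: logwarp_le.
      rewrite -[ltLHS](@logwarp_ln _ alpha x)// ?ltW// divr1.
      exact: logwarp_lt.
    have dl : is_derive x 1 (logwarp alpha ^~ t) (expR (- t `^ (1 - alpha)^-1)).
      rewrite /logwarp; apply: is_derive_eq.
      by rewrite scaler0 add0r [LHS]mulr1.
    exact: (@derivable1_comp _ v (logwarp alpha ^~ t) x _ (dv _ d1 d2) dl).
  have x1' : logwarp alpha x t < 1.
    rewrite logwarp_ltE// ?divr1 ?ltW//.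
    by rewrite lt_neqAle Tt andbT; apply/eqP => Tt'; exact: (tT (esym Tt')).
  apply: (@near_eq_derivable _ _ _ (cst (v 1))); last exact: derivable_cst.
  near=> y; rewrite /= [RHS]v1// ltW// /logwarp -ltr_pdivlMr ?expR_gt0//.
  near: y; apply: lt_nbhsl; rewrite ltr_pdivlMr ?expR_gt0//.
exact: derivable_affine_comb.
Unshelve. all: by end_near. Qed.

End differentiability.

(** * The Hadamard integral at a maximum *)

Section one_variable_maximum.
Context {R : realType}.
Implicit Types (alpha x y h s t L : R) (v w : R -> R).
Notation mu := (@lebesgue_measure R).

Lemma hadamard_kernel_decreasing alpha x y s : 0 < alpha -> 0 < s ->
  s < y -> y <= x -> ln (x / s) `^ (- alpha) <= ln (y / s) `^ (- alpha).
Proof.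
move=> a0 s0 sy yx.
have ys : 0 < ln (y / s) by rewrite ln_gt0// ltr_pdivlMr// mul1r.
have y0 := lt_trans s0 sy.
have xy : ln (y / s) <= ln (x / s).
  by rewrite ler_ln ?posrE ?divr_gt0// ?(lt_le_trans y0)// ler_pM2r// invr_gt0.
have xs := lt_le_trans ys xy.
rewrite !powRN lef_pV2 ?posrE ?powR_gt0//.
by apply: ge0_ler_powR; rewrite // ?nnegrE ltW.
Qed.

(** The kernel decreases in its first variable, so on [[1, y]] replacing [x] by
    [y] increases the integral of [p >= 0]; what is left is the integral over
    [[y, x]], where [p] is at most [L (x - y)]. *)
Lemma hadamard_gap_le alpha x y L (p : R -> R) :
  0 < alpha < 1 -> 1 < y -> y < x -> continuous p ->
  (forall s, 1 <= s <= x -> 0 <= p s) ->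
  (forall s, 1 <= s <= x -> p s <= L * (x - s)) ->
  \int[mu]_(s in `[1, x]) (ln (x / s) `^ (- alpha) * p s / s) -
  \int[mu]_(s in `[1, y]) (ln (y / s) `^ (- alpha) * p s / s) <=
  L * (x - y) * ((1 - alpha)^-1 * ln (x / y) `^ (1 - alpha)).
Proof.
move=> /[dup] a01 /andP[a0 a1] y1 yx cp p0 pL.
have x1 := lt_trans y1 yx; have y0 : 0 < y by exact: lt_trans y1.
have L0 : 0 <= L.
  have y1x : 1 <= y <= x by rewrite !ltW.
  by have := le_trans (p0 y y1x) (pL y y1x); rewrite pmulr_lge0// subr_gt0.
have ix := integrable_hadamard_integrand a01 ltr01 x1 cp.
have iy := integrable_hadamard_integrand a01 ltr01 y1 cp.
have ixy := integrable_hadamard_integrand a01 y0 yx cp.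
have i1 := integrable_hadamard_kernel a01 y0 yx.
have sub : `[1, y[ `<=` `[1, y] by apply: subset_itvl; rewrite bnd_simp.
have sub' : `[1, y[ `<=` `[1, x].
  by apply: subset_itvl; rewrite bnd_simp ltW.
set kx := fun s => ln (x / s) `^ (- alpha) * p s / s.
set ky := fun s => ln (y / s) `^ (- alpha) * p s / s.
have le1 : \int[mu]_(s in `[1, y]) kx s <= \int[mu]_(s in `[1, y]) ky s.
  (* The endpoint s = y must be dropped: there the kernel of y has the
     conventional value 0. *)
  rewrite -!Rintegral_itv_bndo_bndc; last 2 first.
    exact: integrableS iy.
    exact: integrableS ix.
  apply: le_Rintegral => //.
  - exact: integrableS ix.
  - exact: integrableS iy.
  move=> s /=; rewrite in_itv/= => /andP[s1 sy].
  have s0 : 0 < s by exact: lt_le_trans s1.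
  rewrite ler_pM2r ?invr_gt0// ler_wpM2r//.
    by apply: p0; rewrite s1 ltW// (lt_trans sy).
  by apply: hadamard_kernel_decreasing => //; exact: ltW.
have le2 : \int[mu]_(s in `[y, x]) kx s <=
    L * (x - y) * ((1 - alpha)^-1 * ln (x / y) `^ (1 - alpha)).
  rewrite -(Rintegral_hadamard_cst a01 y0 yx) -RintegralZl//.
  apply: le_Rintegral => //.
    exact: (integrableZl _ _ i1).
  move=> s /=; rewrite in_itv/= => /andP[ys sx].
  have s0 := lt_le_trans y0 ys.
  rewrite mulr1 /kx mulrA ler_pM2r ?invr_gt0// mulrC ler_wpM2r ?powR_ge0//.
  apply: (@le_trans _ _ (L * (x - s))).
    by apply: pL; rewrite sx andbT (le_trans (ltW y1)).
  by rewrite ler_wpM2l// lerD2l lerN2.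
have -> : \int[mu]_(s in `[1, x]) kx s =
    \int[mu]_(s in `[1, y]) kx s + \int[mu]_(s in `[y, x]) kx s.
  apply/eqP; rewrite addrC -subr_eq; apply/eqP.
  rewrite Rintegral_itvB ?bnd_simp// ?ltW//.
  rewrite Rintegral_itv_obnd_cbnd//.
  by apply: integrableS ixy => //; apply: subset_itvr; rewrite bnd_simp.
by rewrite addrAC -lerBrDr (le_trans (y := 0)) ?subr_le0// subr_ge0.
Qed.

(** The Hadamard analogue of the vanishing of the derivative at a maximum. Write
    [v s = v x - p s] with [p >= 0] and [p x = 0]: the constant contributes the
    left-hand side, and the left difference quotients of the part coming from
    [p] have a nonpositive limit by the previous estimate, because the gap is
    [o (x - y)]. *)
Lemma hadamard_integral_derive_max alpha L x v : 0 < alpha < 1 ->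
  1 < x -> (forall s t, `|v s - v t| <= L * `|s - t|) ->
  (forall s, 1 <= s <= x -> v s <= v x) ->
  let I y := \int[mu]_(s in `[1, y])
    (ln (y / s) `^ (- alpha) * v s / s) in
  derivable I x 1 -> v x * (ln x `^ (- alpha) / x) <= 'D_1 I x.
Proof.
move=> /[dup] a01 /andP[a0 a1] x1 vL vmax I dI.
have cv := lipschitz_continuous vL.
pose S y := ln y `^ (1 - alpha).
pose p s := v x - v s.
have cp : continuous p by move=> s; apply: cvgB; [exact: cvg_cst|exact: cv].
pose E y := v x * (1 - alpha)^-1 * S y - I y.
have EE y : 1 < y -> E y = \int[mu]_(s in `[1, y])
    (ln (y / s) `^ (- alpha) * p s / s).
  move=> y1; rewrite /E /I.
  have := Rintegral_hadamard_cst a01 ltr01 y1; rewrite divr1 => iS.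
  rewrite -mulrA -[X in v x * X]iS -RintegralZl//; last first.
    exact: integrable_hadamard_kernel.
  rewrite -RintegralB//.
  - apply: eq_Rintegral => s _; rewrite /p; ring.
  - apply: (integrableZl _ _ (integrable_hadamard_kernel a01 ltr01 y1)) => //.
  - exact: integrable_hadamard_integrand.
have dS := is_derive_ln_powR (1 - alpha) x1.
have {}dS : is_derive x 1 S ((1 - alpha) * ln x `^ (- alpha) / x).
  by move: dS; rewrite addrAC subrr add0r.
have dE : is_derive x 1 E
    (v x * (1 - alpha)^-1 * ((1 - alpha) * ln x `^ (- alpha) / x) - 'D_1 I x).
  exact: is_derive_lincomb dS (derivableP dI).
suff : 'D_1 E x <= 0.
  case: dE => _ ->; rewrite subr_le0; congr (_ <= _); field.
  by rewrite subr_eq0 !gt_eqF// (lt_trans _ x1).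
have L1 := cvg_dnbhs_at_left (@ex_derive _ _ _ _ _ _ _ dE).
have b1 : 0 < 1 - alpha by rewrite subr_gt0.
(* The left difference quotient of E at distance -e is at most
   L/(1-alpha) * (ln (x/(x+e)))^(1-alpha), and ln (x/(x+e)) <= -e. *)
have L2 : L * (1 - alpha)^-1 * (- e) `^ (1 - alpha) @[e --> 0^'-] --> (0 : R).
  rewrite -[X in _ --> X](mulr0 (L * (1 - alpha)^-1)).
  apply: cvgM; first exact: cvg_cst.
  apply/cvg_at_leftNP; rewrite oppr0.
  apply: cvg_trans (powR_cvg0 b1); apply: near_eq_cvg; apply: nearW => e /=.
  by rewrite opprK.
apply: (ler_cvg_to L1 L2); near=> e.
have e0 : e < 0 by near: e; exact: nbhs_left_lt.
have ex1 : 1 < e + x.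
  by rewrite -ltrBlDr; near: e; apply: nbhs_left_gt; rewrite subr_lt0.
have exx : e + x < x by rewrite gtrDr.
rewrite /= [e%:A]mulr1 /GRing.scale/= ler_ndivrMl// !EE//.
rewrite -lerN2 opprB.
have p0 s : 1 <= s <= x -> 0 <= p s by move=> /vmax; rewrite subr_ge0.
have pL s : 1 <= s <= x -> p s <= L * (x - s).
  move=> /andP[s1 sx]; apply: le_trans (ler_norm _) _.
  by apply: le_trans (vL _ _) _; rewrite ger0_norm ?subr_ge0.
apply: le_trans (hadamard_gap_le a01 ex1 exx cp p0 pL) _.
have L0 : 0 <= L.
  by have := vL 1 0; rewrite subr0 normr1 mulr1; exact: le_trans.
have lne : ln (x / (e + x)) `^ (1 - alpha) <= (- e) `^ (1 - alpha).
  apply: ge0_ler_powR; first exact: ltW.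
  - by rewrite nnegrE ln_ge0// ler_pdivlMr ?mul1r ?(ltW exx)// (lt_trans _ ex1).
  - by rewrite nnegrE oppr_ge0 ltW.
  - by have := ln_div_le ex1 (ltW exx); rewrite opprD addrCA subrr addr0.
have -> : x - (e + x) = - e by ring.
rewrite -mulNr !mulrA [leRHS]mulrAC.
rewrite (_ : - e * L * (- e) `^ _ / _ =
  L * - e / (1 - alpha) * (- e) `^ (1 - alpha)).
  by rewrite ler_wpM2l// divr_ge0 ?(ltW b1)// mulr_ge0// oppr_ge0 ltW.
by rewrite mulrAC [- e * L]mulrC.
Unshelve. all: by end_near. Qed.

(** Truncating [w] to [[1, h]] gives a Lipschitz function on the line that is
    constant on the left of [1]; near [x] the two integrals agree, so that the
    existence of the derivative and its lower bound apply. *)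
Lemma hadamard_derive_max_gt0 alpha h L x w : 0 < alpha < 1 -> 1 < x -> x < h ->
  {within `[1, h], continuous w} ->
  (forall s, s \in `]1, h[ -> derivable w s 1) ->
  (forall s, s \in `]1, h[ -> `|'D_1 w s| <= L) ->
  (forall s, s \in `[1, h] -> w s <= w x) -> 0 < w x ->
  0 < 'D_1 (fun y => \int[mu]_(s in `[1, y])
     (ln (y / s) `^ (- alpha) * w s / s)) x.
Proof.
move=> a01 x1 xh cw dw wL wmax wx0.
have h1 := lt_trans x1 xh.
have x0 : 0 < x by exact: lt_trans x1.
pose v s := w (Num.max 1 (Num.min s h)).
have vw s : 1 <= s <= h -> v s = w s by move=> sh; rewrite /v clamp_id.
have L0 : 0 <= L by apply: le_trans (normr_ge0 _) (wL x _); rewrite in_itv/= x1.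
have vL s t : `|v s - v t| <= L * `|s - t|.
  apply: le_trans (bounded_derive_lipschitz cw dw wL _ _) _.
  - by apply: clamp_in; exact: ltW.
  - by apply: clamp_in; exact: ltW.
  - by rewrite ler_wpM2l// clamp_dist.
have v1 s : s <= 1 -> v s = v 1.
  move=> s1; rewrite /v; congr w.
  by rewrite !min_l ?(ltW h1) ?(le_trans s1) ?(ltW h1)// maxxx max_l.
have dv s : 1 < s -> s < h -> derivable v s 1.
  move=> s1 sh.
  apply: (@near_eq_derivable _ _ _ w); last by apply: dw; rewrite in_itv/= s1.
  near=> t; rewrite vw//; apply/andP; split; apply/ltW; near: t.
    exact: lt_nbhsr.
  exact: lt_nbhsl.
have vx : v x = w x by rewrite vw// !ltW.
have dI := derivable_hadamard_integral a01 x1 xh vL v1 dv.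
have vmax s : 1 <= s <= x -> v s <= v x.
  move=> /andP[s1 sx]; rewrite vx vw ?s1 ?(le_trans sx (ltW xh))//.
  by apply: wmax; rewrite in_itv/= s1 (le_trans sx (ltW xh)).
have := hadamard_integral_derive_max a01 x1 vL vmax dI; rewrite vx.
rewrite (@near_eq_derive _ _ _ _ (fun y => \int[mu]_(s in `[1, y])
     (ln (y / s) `^ (- alpha) * w s / s))); last first.
  near=> y; apply: eq_Rintegral => s; rewrite inE/= in_itv/= => /andP[s1 sy].
  rewrite vw// s1 (le_trans sy)// ltW//; near: y; exact: lt_nbhsl.
apply: lt_le_trans; rewrite mulr_gt0// divr_gt0// powR_gt0//; exact: ln_gt0.
Unshelve. all: by end_near. Qed.

End one_variable_maximum.

(** * Positivity of the Gamma function *)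

Section gamma.
Context {R : realType}.
Implicit Types (z t : R).
Notation mu := (@lebesgue_measure R).

Lemma is_derive_ratio t : 0 < 1 + t ->
  is_derive t 1 (fun t => t / (1 + t)) ((1 + t) ^- 2).
Proof.
move=> t1; have t1' : 1 + t != 0 by rewrite gt_eqF.
have dV : is_derive t 1 (fun t => (1 + t)^-1) (- (1 + t) ^- 2).
  have d1 : is_derive t 1 (fun t => 1 + t) (1 : R).
    by apply: is_derive_eq; rewrite add0r mulr1.
  by have := is_deriveV t1' d1; rewrite [_ *: 1]mulr1.
by apply: is_derive_eq; rewrite [_%:A]mulr1 /GRing.scale/=; field.
Qed.

Lemma is_derive_ratio_powR p t : 0 < t ->
  is_derive t 1 (fun t => (t / (1 + t)) `^ p)
    (p * (t / (1 + t)) `^ (p - 1) * (1 + t) ^- 2).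
Proof.
move=> t0; have t1 : 0 < 1 + t by rewrite addr_gt0.
have q0 : 0 < t / (1 + t) by rewrite divr_gt0.
exact: (@is_derive1_comp _ (fun s => s `^ p) (fun t => t / (1 + t)) t _ _
  (is_derive1_powR p q0) (is_derive_ratio t1)).
Qed.

(** This function is bounded and its derivative behaves like [t^(z-1)] at [0]
    and like [t^(-2)] at infinity, so that it controls both ends of Euler's
    integral. *)
Lemma is_derive_Gamma_majorant z t : 0 < z -> 0 < t ->
  is_derive t 1 (fun t => z^-1 * (t / (1 + t)) `^ z)
    ((t / (1 + t)) `^ (z - 1) * (1 + t) ^- 2).
Proof.
move=> z0 t0; have t1 : 0 < 1 + t by rewrite addr_gt0.
have dc := is_derive_ratio_powR z t0.
apply: is_derive_eq; rewrite /GRing.scale/=; field.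
by rewrite !gt_eqF.
Qed.

Lemma Gamma_integrand_le z t : 0 < z <= 1 -> 0 < t ->
  t `^ (z - 1) * expR (- t) <= 4 * ((t / (1 + t)) `^ (z - 1) * (1 + t) ^- 2).
Proof.
move=> /andP[z0 z1] t0; have t1 : 0 < 1 + t by rewrite addr_gt0.
have q0 : 0 < t / (1 + t) by rewrite divr_gt0.
rewrite mulrCA; apply: ler_pM; rewrite ?powR_ge0 ?expR_ge0//.
  have -> : z - 1 = - (1 - z) by rewrite opprB.
  rewrite !powRN lef_pV2 ?posrE ?powR_gt0//.
  apply: ge0_ler_powR; rewrite ?subr_ge0 ?nnegrE ?(ltW t0) ?(ltW q0)//.
  by rewrite ler_pdivrMr// ler_pMr// lerDl ltW.
(* From exp t >= 1 + t^2/2 one gets (1 + t)^2 <= 4 exp t, whence the 4. *)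
rewrite expRN ler_pdivlMr ?exprn_gt0// ler_pdivrMl ?expR_gt0//.
have := @expR_ge1Dxn R t 1 (ltW t0); rewrite (_ : 2`! = 2)%N// => le.
apply: (@le_trans _ _ ((1 + t ^+ 2 / 2) * 4)); last by rewrite ler_pM2r.
nra.
Qed.

(** The point is finiteness: an infinite integral would be read as [0]. *)
Lemma Gamma_gt0 z : 0 < z <= 1 -> 0 < Gamma z.
Proof.
move=> /[dup] z01 /andP[z0 z1]; rewrite /Gamma /Rintegral.
set f : R -> R := fun t => t `^ (z - 1) * expR (- t).
have mf (D : set R) : measurable_fun D (EFin \o f).
  apply/measurable_EFinP/measurable_funTS/measurable_funM.
    exact: measurable_powR.
  by apply: measurableT_comp => //; exact: measurable_expR.
have f0 t : 0 <= f t by rewrite mulr_ge0 ?powR_ge0 ?expR_ge0.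
apply: fine_gt0; apply/andP; split.
  apply: (@lt_le_trans _ _ (\int[mu]_(t in `[1%R, 2%R])
      (2 `^ (z - 1) * expR (- 2))%:E)%E).
    rewrite integral_cst//= lebesgue_measure_itv/= lte_fin ltr1n -EFinD -EFinM.
    by rewrite lte_fin !mulr_gt0 ?powR_gt0 ?expR_gt0// subr_gt0 ltr1n.
  apply: (@le_trans _ _ (\int[mu]_(t in `[1%R, 2%R]) (f t)%:E)%E).
    apply: ge0_le_integral => //; first exact: mf.
    move=> t /=; rewrite in_itv/= lee_fin => /andP[t1 t2].
    have t0 : 0 < t by exact: lt_le_trans t1.
    rewrite /f ler_pM ?powR_ge0 ?expR_ge0 ?ler_expR ?lerN2//.
    have -> : z - 1 = - (1 - z) by rewrite opprB.
    rewrite !powRN lef_pV2 ?posrE ?powR_gt0//.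
    by apply: ge0_ler_powR; rewrite ?subr_ge0 ?nnegrE// ltW.
  apply: ge0_subset_integral => //.
  - exact: mf.
  - by move=> t _; rewrite lee_fin f0.
  - move=> t /=; rewrite !in_itv/= andbT => /andP[t1 _].
    exact: lt_le_trans t1.
apply: (@le_lt_trans _ _ (4 / z)%:E); last by rewrite ltry.
pose F n := `[(n.+1%:R)^-1 : R, n.+1%:R]%classic.
apply: (@le_trans _ _ (\int[mu]_(t in \bigcup_n F n) (f t)%:E)%E).
  apply: ge0_subset_integral => //.
  - by apply: bigcup_measurable => n _; exact: measurable_itv.
  - exact: mf.
  - by move=> t _; rewrite lee_fin f0.
  - move=> t /=; rewrite in_itv/= andbT => t0.
    have tt0 : 0 < t + t^-1 by rewrite addr_gt0// invr_gt0.
    have tn := archi_boundP (ltW tt0); set n := Num.bound _ in tn.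
    exists n => //=; rewrite /F/= in_itv/=.
    have nn : t + t^-1 <= n.+1%:R by rewrite (le_trans (ltW tn))// ler_nat.
    apply/andP; split; last by rewrite (le_trans _ nn)// lerDl invr_ge0 ltW.
    rewrite -[leRHS]invrK lef_pV2 ?posrE ?invr_gt0//.
    by rewrite (le_trans _ nn)// lerDr ltW.
apply: ge0_integral_bigcup_le => //.
- move=> m n mn; rewrite subsetEset; apply: subset_itv; rewrite bnd_simp.
    by rewrite lef_pV2 ?posrE// ler_nat.
  by rewrite ler_nat.
- by move=> n; exact: measurable_itv.
- by move=> n; exact: mf.
- by move=> n t _; rewrite lee_fin f0.
move=> n.
pose H (t : R) := 4 * (z^-1 * (t / (1 + t)) `^ z).
pose h (t : R) := 4 * ((t / (1 + t)) `^ (z - 1) * (1 + t) ^- 2).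
have n0 : 0 < n.+1%:R^-1 :> R by rewrite invr_gt0.
have dH t : 0 < t -> is_derive t 1 H (h t).
  move=> t0; have dM := is_derive_Gamma_majorant z0 t0.
  by apply: is_derive_eq.
have ch t : 0 < t -> {for t, continuous h}.
  move=> t0; have t1 : 0 < 1 + t by rewrite addr_gt0.
  apply: cvgM; first exact: cvg_cst.
  apply: cvgM.
    exact: is_derive_continuous (is_derive_ratio_powR (z - 1) t0).
  apply: cvgV; first by rewrite expf_neq0// gt_eqF.
  by apply: cvgM; (apply: cvgD; [exact: cvg_cst|exact: cvg_id]).
have chF : {within F n, continuous h}.
  apply: continuous_in_subspaceT => t; rewrite inE/F/= in_itv/= => /andP[nt _].
  by apply: ch; exact: lt_le_trans nt.
have [->|n1] := eqVneq n 0%N.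
  by rewrite /F invr1 set_itv1 integral_set1 lee_fin divr_ge0// ltW.
have nn : n.+1%:R^-1 < n.+1%:R :> R.
  by rewrite (@lt_trans _ _ 1)// ?invf_lt1// ltr1n ltnS lt0n.
apply: (@le_trans _ _ (\int[mu]_(t in F n) (h t)%:E)%E).
  apply: ge0_le_integral => //.
  - exact: measurable_itv.
  - by move=> t _; rewrite lee_fin f0.
  - exact: mf.
  - apply/measurable_EFinP; apply: subspace_continuous_measurable_fun => //.
    exact: measurable_itv.
  move=> t; rewrite /F/= in_itv/= lee_fin => /andP[nt _].
  by apply: Gamma_integrand_le => //; exact: lt_le_trans nt.
rewrite (@continuous_FTC2 _ h H)//; last 2 first.
- split.
  + move=> t; rewrite in_itv/= => /andP[nt _].
    by have [] := dH t (lt_trans n0 nt).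
  + by apply: cvg_at_right_filter; exact: is_derive_continuous (dH _ _).
  + by apply: cvg_at_left_filter; exact: is_derive_continuous (dH _ _).
- move=> t; rewrite in_itv/= => /andP[nt _].
  by rewrite derive1E; have [_ ->] := dH t (lt_trans n0 nt).
rewrite -EFinB lee_fin lerBlDr (@le_trans _ _ (4 / z))//.
  rewrite /H ler_pM2l// ler_piMr ?invr_ge0 ?(ltW z0)//.
  apply: (@le_trans _ _ (1 `^ z)); last by rewrite powR1.
  apply: ge0_ler_powR; rewrite ?nnegrE ?ler01 ?(ltW z0)//.
  by rewrite ler_pdivrMr ?addr_gt0// mul1r lerDr.
by rewrite lerDl /H !mulr_ge0 ?invr_ge0 ?(ltW z0)// powR_ge0.
Qed.

End gamma.

(** * Coordinate lines and boxes *)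

Section row_vectors.
Context {R : realType} {n : nat}.
Implicit Types (x : 'rV[R]_n) (j : 'I_n) (f u : 'rV[R]_n -> R)
  (h : 'I_n -> R).

(** Moving one coordinate is moving along a coordinate line; hence partial
    derivatives are ordinary derivatives of one-variable sections. *)
Lemma set_coordE x j s : set_coord x j s = x + (s - x 0 j) *: delta_mx 0 j.
Proof.
apply/rowP => k; rewrite !mxE eqxx/=; case: eqVneq => [->|_].
  by rewrite mulr1 subrKC.
by rewrite mulr0 addr0.
Qed.

Lemma set_coord_id x j : set_coord x j (x 0 j) = x.
Proof. by rewrite set_coordE subrr scale0r addr0. Qed.

Lemma set_coordK x j s t : set_coord (set_coord x j s) j t = set_coord x j t.
Proof. by apply/rowP => k; rewrite !mxE; case: eqVneq. Qed.

Lemma set_coord_coord x j s : set_coord x j s 0 j = s.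
Proof. by rewrite mxE eqxx. Qed.

Lemma continuous_set_coord x j : continuous (set_coord x j : R -> 'rV[R]_n).
Proof.
move=> s.
rewrite (_ : set_coord x j = fun s => x + (s - x 0 j) *: delta_mx 0 j).
  apply: cvgD; first exact: cvg_cst.
  apply: cvgZr_tmp; apply: cvgB; [exact: cvg_id|exact: cvg_cst].
by apply/funext => t; rewrite set_coordE.
Qed.

Lemma diff_quotient_set_coord f x j s :
  (fun e : R => e^-1 *: ((f \o shift (set_coord x j s)) (e *: delta_mx 0 j)
    - f (set_coord x j s))) =
  (fun e : R => e^-1 *: (((fun t => f (set_coord x j t)) \o shift s)
    (e *: (1 : R)) - f (set_coord x j s))).
Proof.
apply/funext => e /=; congr (_ *: (f _ - _)).
rewrite [e *: 1]mulr1 !set_coordE addrCA -scalerDl; congr (_ + _ *: _); ring.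
Qed.

Lemma derivable_set_coord f x j s :
  derivable f (set_coord x j s) (delta_mx 0 j) =
  derivable (fun t => f (set_coord x j t)) s 1.
Proof. by rewrite /derivable diff_quotient_set_coord. Qed.

Lemma partial_set_coord f x j s :
  partial j f (set_coord x j s) = 'D_1 (fun t => f (set_coord x j t)) s.
Proof. by rewrite /partial /derive diff_quotient_set_coord. Qed.

Lemma box_set_coord h x j s : box h x -> 1 < s < h j ->
  box h (set_coord x j s).
Proof.
by move=> xh sh k; rewrite mxE; case: eqVneq => [->|_]; [exact: sh|exact: xh].
Qed.

(** The faces [s = 1] and [s = h j] are reached as one-sided limits. *)
Lemma closure_box_set_coord h x j s : 1 < h j -> box h x -> 1 <= s <= h j ->
  closure (box h) (set_coord x j s).
Proof.
move=> hj xh /andP[s1 sh] B /(@continuous_set_coord x j s) sB.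
have {}sB : \forall t \near nbhs s, B (set_coord x j t) := sB.
have inB t : 1 < t < h j -> B (set_coord x j t) -> box h `&` B !=set0.
  by move=> th Bt; exists (set_coord x j t); split => //; exact: box_set_coord.
move: s1; rewrite le_eqVlt => /predU1P[s1|s1].
  have {}sB : \forall t \near nbhs (1 : R), B (set_coord x j t) by rewrite s1.
  near (1 : R)^'+ => t; apply: (inB t).
    by apply/andP; split; near: t; [exact: nbhs_right_gt|exact: nbhs_right_lt].
  near: t; rewrite near_withinE; apply: filterS sB => t + _; exact.
have hj' := lt_le_trans s1 sh.
near s^'- => t; apply: (inB t).
  apply/andP; split; first by near: t; exact: nbhs_left_gt.
  by rewrite (lt_le_trans _ sh)//; near: t; exact: nbhs_left_lt.
near: t; rewrite near_withinE; apply: filterS sB => t + _; exact.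
Unshelve. all: by end_near. Qed.

Lemma compact_closure_box h : compact (closure (box h)).
Proof.
pose A (i : 'I_n) : set R := `[1, h i]%classic.
have cA : compact [set v : 'rV[R]_n | forall i, A i (v ord0 i)].
  by apply: rV_compact => i; exact: segment_compact.
have clA := compact_closed (@norm_hausdorff _ _) cA.
apply: subclosed_compact cA _; first exact: closed_closure.
rewrite [X in _ `<=` X]((closure_id _).1 clA); apply: closure_subset => x xh i.
by rewrite /A/= in_itv/=; have /andP[/ltW -> /ltW ->] := xh i.
Qed.

Lemma boundary_set_coord1 h x j : 1 < h j -> box h x ->
  boundary (box h) (set_coord x j 1).
Proof.
move=> hj xh; split.
  by apply: closure_box_set_coord => //; rewrite lexx ltW.
by move=> /interior_subset/(_ j); rewrite set_coord_coord ltxx.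
Qed.

Lemma compact_boundary_box h : compact (boundary (box h)).
Proof.
apply: subclosed_compact (@compact_closure_box h) _.
  rewrite /boundary setDE; apply: closedI; first exact: closed_closure.
  by apply: open_closedC; exact: open_interior.
by move=> x [].
Qed.

Lemma within_continuous_set_coord h x j u : 1 < h j -> box h x ->
  {within closure (box h), continuous u} ->
  {within `[1, h j], continuous (fun s => u (set_coord x j s))}.
Proof.
move=> hj xh /subspace_continuousP cu; apply/subspace_continuousP => s /= sh.
have cs : closure (box h) (set_coord x j s).
  by apply: closure_box_set_coord => //; move: sh; rewrite in_itv.
apply: (@cvg_comp _ _ _ (set_coord x j) u _ _ _ _ (cu _ cs)) => P.
rewrite /within/= => /(@continuous_set_coord x j s) nP.
have {}nP : \forall t \near nbhs s, closure (box h) (set_coord x j t) ->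
  P (set_coord x j t) := nP.
apply: filterS nP => t tP th; apply: tP.
by apply: closure_box_set_coord => //; move: th; rewrite in_itv.
Qed.

End row_vectors.

(** * Interior maxima and the maximum principle *)

Section interior_maximum.
Context {R : realType} {n : nat}.
Implicit Types (x : 'rV[R]_n) (j : 'I_n) (u : 'rV[R]_n -> R)
  (h : 'I_n -> R).

Lemma partial_max h x j u : box h x ->
  (forall y, box h y -> derivable u y (delta_mx 0 j)) ->
  derivable (partial j u) x (delta_mx 0 j) ->
  (forall y, box h y -> u y <= u x) ->
  partial j u x = 0 /\ partial j (partial j u) x <= 0.
Proof.
move=> xh du ddu umax.
have := xh j; set a := x 0 j => /andP[a1 ah].
have inh s : s \in `]1, h j[ -> box h (set_coord x j s).
  by rewrite in_itv; exact: box_set_coord.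
have xE : set_coord x j a = x by exact: set_coord_id.
pose w s := u (set_coord x j s).
have Dw : (fun s => partial j u (set_coord x j s)) = 'D_1 w.
  by apply/funext => s; rewrite partial_set_coord.
have := @second_derivative_max _ w 1 (h j) a a1 ah.
rewrite -{1}xE partial_set_coord -[X in partial j (partial j u) X]xE.
rewrite partial_set_coord Dw; apply.
- by move=> s /inh sh; rewrite -derivable_set_coord; exact: du.
- by rewrite -Dw -derivable_set_coord xE.
- by move=> s /inh sh; rewrite /w xE; exact: umax.
Qed.

(** The integral reads [u] on a line parallel to the [j]-th axis, which is the
    same for all points of that line; so only the kernel and the upper limit
    vary. *)
Lemma hadamard_set_coord alpha x j u :
  hadamard alpha j u x = (Gamma (1 - alpha))^-1 * (x 0 j *
    'D_1 (fun y : R => \int[@lebesgue_measure R]_(s in `[1, y])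
      (ln (y / s) `^ (- alpha) * u (set_coord x j s) / s)) (x 0 j)).
Proof.
rewrite /hadamard -[X in partial _ _ X](set_coord_id x j) partial_set_coord.
rewrite [X in derive X _ _](_ : _ = (fun y : R => \int[@lebesgue_measure R]_(s in
    `[1, y]) (ln (y / s) `^ (- alpha) * u (set_coord x j s) / s)))//.
apply/funext => y; rewrite set_coord_coord.
by apply: eq_Rintegral => s _; rewrite set_coordK.
Qed.

(** The bound on the first partial derivatives up to the boundary is where [C^1]
    on the closed box is used: it makes the sections Lipschitz up to the face
    [x_j = 1], the base point of the fractional derivative. *)
Lemma hadamard_max_gt0 alpha h x j u : 0 < alpha < 1 -> 1 < h j -> box h x ->
  C1_closure (box h) u -> (forall y, closure (box h) y -> u y <= u x) ->
  0 < u x -> 0 < hadamard alpha j u x.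
Proof.
move=> /[dup] a01 /andP[a0 a1] hj xh [cu /(_ j)[du [g cg gE]]] umax ux0.
have := xh j; set a := x 0 j => /andP[a1' ah].
have inh s : s \in `]1, h j[ -> box h (set_coord x j s).
  by rewrite in_itv; exact: box_set_coord.
have xE : set_coord x j a = x by exact: set_coord_id.
have /compact_bounded/ex_strict_bound_gt0[L L0 /= gL] :
    compact (g @` closure (box h)).
  by apply: continuous_compact (@compact_closure_box _ _ h).
rewrite hadamard_set_coord mulr_gt0//.
  by rewrite invr_gt0 Gamma_gt0// subr_gt0 a1 gerBl ltW.
rewrite mulr_gt0// ?(lt_trans _ a1')//.
apply: (@hadamard_derive_max_gt0 _ _ (h j) L) => //.
- exact: within_continuous_set_coord.
- by move=> s /inh sh; rewrite -derivable_set_coord; exact: du.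
- move=> s /inh sh; rewrite -partial_set_coord -gE// ltW//; apply: gL.
  by exists (set_coord x j s) => //; exact: subset_closure.
- move=> s; rewrite in_itv/= xE => sh; apply: umax.
  exact: closure_box_set_coord.
- by rewrite xE.
Qed.

End interior_maximum.

Theorem theorem6p1 (R : realType) (n : nat) (hn : (0 < n)%N)
    (alpha : R) (halpha : 0 < alpha < 1)
    (h : 'I_n -> R) (hh : forall j, 1 < h j)
    (a b : 'I_n -> 'rV[R]_n -> R) (c F : 'rV[R]_n -> R)
    (hb : forall j x, closure (box h) x -> b j x < 0)
    (hc : forall x, closure (box h) x -> c x <= 0)
    (u : 'rV[R]_n -> R)
    (hu2 : Ck 2 (box h) u) (hu1 : C1_closure (box h) u)
    (hequ : forall x, box h x ->
      laplacian u x + \sum_(j < n) a j x * partial j u x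
      + \sum_(j < n) b j x * hadamard alpha j u x + c x * u x = F x)
    (hF : forall x, box h x -> 0 <= F x) :
  exists M m : R,
    [/\ is_max (u @` closure (box h)) M,
        is_max (u @` boundary (box h)) m
      & M <= Num.max m 0].
Proof.
have j0 : 'I_n := Ordinal hn.
pose x0 : 'rV[R]_n := \row_j ((1 + h j) / 2).
have x0h : box h x0.
  by move=> j; rewrite mxE; have := hh j; lra.
have cu : {within closure (box h), continuous u} by case: hu1.
have [x /set_mem xcl xmax] := compact_EVT_max
  (ex_intro _ x0 (subset_closure x0h)) (@compact_closure_box _ _ h) cu.
have [y /set_mem ybd ymax] : exists2 y, y \in boundary (box h) &
    forall t, t \in boundary (box h) -> u t <= u y.
  apply: compact_EVT_max; last by apply: continuous_subspaceW cu => ? [].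
  - by exists (set_coord x0 j0 1); exact: boundary_set_coord1.
  - exact: compact_boundary_box.
exists (u x), (u y); split.
- split; first by exists x.
  by move=> _ [t tcl <-]; apply: xmax; rewrite inE.
- split; first by exists y.
  by move=> _ [t tbd <-]; apply: ymax; rewrite inE.
have [xint|xbd] := pselect ((box h)^° x); last first.
  by rewrite le_max ymax// inE.
rewrite leNgt; apply/negP; rewrite gt_max => /andP[_ ux0].
have xh : box h x by exact: interior_subset.
have umax t : closure (box h) t -> u t <= u x by move=> tcl; rewrite xmax ?inE.
have pmax j : partial j u x = 0 /\ partial j (partial j u) x <= 0.
  have [_ /(_ j)[du [_ /(_ j)[ddu _]]]] := hu2.
  apply: (@partial_max _ _ h) => //; first exact: ddu.
  by move=> t th; apply: umax; exact: subset_closure.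
have := hF x xh; rewrite -hequ// leNgt => /negP; apply.
have lap : laplacian u x <= 0.
  by rewrite /laplacian; apply: sumr_le0 => j _; have [] := pmax j.
have grad : \sum_(j < n) a j x * partial j u x = 0.
  by apply: big1 => j _; have [-> _] := pmax j; rewrite mulr0.
have had j : b j x * hadamard alpha j u x < 0.
  rewrite nmulr_rlt0 ?(@hadamard_max_gt0 _ _ _ h)//.
  by apply: hb; exact: subset_closure.
have frac : \sum_(j < n) b j x * hadamard alpha j u x < 0.
  rewrite (bigD1 j0)//= -[ltRHS]addr0 ltr_leD//.
  by apply: sumr_le0 => j _; exact: ltW.
have zero : c x * u x <= 0 by rewrite mulr_le0_ge0 ?hc// ltW.
by rewrite grad addr0; lra.
Qed.
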